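(* Let $n\ge 2$, let $$\Omega=\{(i,i): 1\le i\le n\}\cup\{(i,i-1): 2\le i\le n\}\cup\{(1,n)\}\cup\{(1,j): 2\le j\le n-1\},$$ and let $A_{ij}>0$ for $(i,j)\in\Omega$. Let $z^*\in\mathbb R^{2n}$ be an optimal solution of the problem $(\mathrm P)$ defined in the context, and let $\mathcal K$ be either $\mathbb S^{2n}_+$ or $\mathcal{DNN}^{2n}$. If $$\frac{z^*_{n+j}}{z^*_i}\ge 1\qquad\text{for all }(i,j)\in\Omega,$$ then for each $\theta\in\{0,1\}$ the conic relaxation $(\mathrm R_\theta)$ defined in the context admits $z^*(z^* )^T$ as a rank-one optimal solution. Consequently, the relaxation $(\mathrm R_0)$ of $(\mathrm P)$ and the relaxation $(\mathrm R_1)$ of $(\mathrm P')$ are both tight.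
   Context: $\mathbb S^s$: real symmetric $s\times s$ matrices; $\mathbb S^s_+$: positive semidefinite ones; $\mathcal{DNN}^s$: those that are positive semidefinite and elementwise nonnegative. $M\bullet N=\mathrm{trace}(MN)$. $E_{ii}=e^i(e^i)^T$ and $E_{ij}=e^i(e^j)^T+e^j(e^i)^T$ for $i\neq j$. The problems below come from completing a partially specified $n\times n$ matrix $(A_{ij})_{(i,j)\in\Omega}$ to a rank-one nonnegative matrix. $(\mathrm P)$: minimize $\sum_{i=1}^{2n}z_i^2$ over $z\in\mathbb R^{2n}$ subject to $A_{ij}-z_iz_{n+j}=0$ for $(i,j)\in\Omega$, $\sum_{i=1}^{2n}z_i^2\le r$, $z_1=1$, $z\ge 0$. $(\mathrm P')$: minimize $\sum_{i=1}^{2n}z_i^2+2\rho\sum_{(i,j)\in\Omega}z_iz_{n+j}$ over $z\in\mathbb R^{2n}$ subject to $A_{ij}-z_iz_{n+j}\le 0$ for $(i,j)\in\Omega$, $\sum_{i=1}^{2n}z_i^2\le r$, $z_1=1$, $z\ge0$. $(\mathrm R_\theta)$, $\theta\in\{0,1\}$: minimize $\big(I+\theta\rho\sum_{(i,j)\in\Omega}E_{i,n+j}\big)\bullet Z$ over $Z\in\mathcal K$ subject to $(2A_{ij}E_{11}-E_{i,n+j})\bullet Z=0$ if $\theta=0$, respectively $\le 0$ if $\theta=1$, for $(i,j)\in\Omega$; $(I-rE_{11})\bullet Z\le 0$; $Z_{11}=1$; $E_{1j}\bullet Z\ge 0$ for $j=2,\dots,2n$. $(\mathrm R_0)$ is a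 relaxation of $(\mathrm P)$ and $(\mathrm R_1)$ is a relaxation of $(\mathrm P')$. A relaxation is tight if its optimal value equals that of the problem it relaxes. $r>0$ and $\rho>0$ are fixed constants (the same in all problems) taken sufficiently large: the claim is asserted for all $r\ge r_0$ and $\rho\ge\rho_0$, for some thresholds $r_0,\rho_0>0$ depending only on $n,\Omega,A$. *)

(* Defs.v *)
(* MathComp / MathComp-Analysis *)
From HB Require Import structures.
From mathcomp Require Import all_boot all_order all_algebra.
From mathcomp Require Import boolp classical_sets reals constructive_ereal ereal.
Set Implicit Arguments.
Unset Strict Implicit.
Unset Printing Implicit Defensive.
Import Order.TTheory GRing.Theory Num.Theory.
Local Open Scope classical_set_scope.
Local Open Scope ring_scope.

(* An optimization problem is a pair of a feasible set F and an objective f,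
   to be minimized. *)
Definition is_minimizer (R : realType) (T : Type) (F : set T) (f : T -> R)
    (x : T) : Prop :=
  F x /\ forall y, F y -> f x <= f y.

Definition optimal_value (R : realType) (T : Type) (F : set T) (f : T -> R) :
    \bar R :=
  ereal_inf [set (f x)%:E | x in F].

Definition psd_cone (R : realType) (s : nat) : set 'M[R]_s :=
  [set M | M^T = M /\ forall x : 'cV[R]_s, 0 <= (x^T *m M *m x) 0 0].

Definition dnn_cone (R : realType) (s : nat) : set 'M[R]_s :=
  [set M | psd_cone M /\ forall i j, 0 <= M i j].

Definition trdot (R : realType) (s : nat) (M N : 'M[R]_s) : R := \tr (M *m N).

Definition Emx (R : realType) (s : nat) (i j : 'I_s) : 'M[R]_s :=
  if i == j then delta_mx i i else delta_mx i j + delta_mx j i.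

(* The matrix to be completed has size N = n.+2, i.e. an arbitrary N >= 2.
   Vectors z have N + N coordinates: the i-th one of the first half is
   [lshift N i], the j-th one of the second half (index N + j) is [rshift N j].
   Indices start from 0, so the first index of all is [idx1] below. *)
Definition idx1 (n : nat) : 'I_(n.+2 + n.+2) := lshift n.+2 ord0.

(* 0-based form of {(i,i)} U {(i,i-1) : 2 <= i <= N} U {(1,N)}
   U {(1,j) : 2 <= j <= N-1}. *)
Definition Omega (n : nat) : {set 'I_n.+2 * 'I_n.+2} :=
  ([set p : 'I_n.+2 * 'I_n.+2 | p.1 == p.2]
   :|: [set p : 'I_n.+2 * 'I_n.+2 | val p.1 == (val p.2).+1]
   :|: [set (ord0, ord_max)]
   :|: [set p : 'I_n.+2 * 'I_n.+2 |
          [&& p.1 == ord0, 1 <= val p.2 & val p.2 < n.+1]%N])%SET.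

Definition P_obj (R : realType) (n : nat) (z : 'cV[R]_(n.+2 + n.+2)) : R :=
  \sum_k z k 0 ^+ 2.

(* Only the entries of A indexed by Omega matter. *)
Definition P_feas (R : realType) (n : nat) (A : 'M[R]_n.+2) (r : R) :
    set 'cV[R]_(n.+2 + n.+2) :=
  [set z |
    [/\ forall p, p \in Omega n ->
          A p.1 p.2 - z (lshift n.+2 p.1) 0 * z (rshift n.+2 p.2) 0 = 0,
        \sum_k z k 0 ^+ 2 <= r,
        z (idx1 n) 0 = 1
      & forall k, 0 <= z k 0]].

Definition P'_obj (R : realType) (n : nat) (rho : R)
    (z : 'cV[R]_(n.+2 + n.+2)) : R :=
  \sum_k z k 0 ^+ 2 +
  2 * rho * \sum_(p in Omega n)
              z (lshift n.+2 p.1) 0 * z (rshift n.+2 p.2) 0.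

Definition P'_feas (R : realType) (n : nat) (A : 'M[R]_n.+2) (r : R) :
    set 'cV[R]_(n.+2 + n.+2) :=
  [set z |
    [/\ forall p, p \in Omega n ->
          A p.1 p.2 - z (lshift n.+2 p.1) 0 * z (rshift n.+2 p.2) 0 <= 0,
        \sum_k z k 0 ^+ 2 <= r,
        z (idx1 n) 0 = 1
      & forall k, 0 <= z k 0]].

(* Conic relaxation (R_theta); the boolean theta stands for 0 or 1. *)
Definition R_obj (R : realType) (n : nat) (rho : R) (theta : bool)
    (Z : 'M[R]_(n.+2 + n.+2)) : R :=
  trdot (1%:M + (theta%:R * rho) *:
           \sum_(p in Omega n) Emx R (lshift n.+2 p.1) (rshift n.+2 p.2)) Z.

Definition R_feas (R : realType) (n : nat) (A : 'M[R]_n.+2) (r : R)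
    (K : set 'M[R]_(n.+2 + n.+2)) (theta : bool) :
    set 'M[R]_(n.+2 + n.+2) :=
  [set Z | K Z /\
    [/\ forall p, p \in Omega n ->
          let c := trdot ((2 * A p.1 p.2) *: Emx R (idx1 n) (idx1 n)
                          - Emx R (lshift n.+2 p.1) (rshift n.+2 p.2)) Z in
          if theta then is_true (c <= 0) else c = 0,
        trdot (1%:M - r *: Emx R (idx1 n) (idx1 n)) Z <= 0,
        Z (idx1 n) (idx1 n) = 1
      & forall j, j != idx1 n -> 0 <= trdot (Emx R (idx1 n) j) Z]].

(* Main.v *)
Require Import Defs.
From HB Require Import structures.
From mathcomp Require Import all_boot all_order all_algebra.
From mathcomp Require Import boolp classical_sets reals constructive_ereal ereal.
From mathcomp Require Import zify ring lra.
Set Implicit Arguments.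
Unset Strict Implicit.
Unset Printing Implicit Defensive.
Import Order.TTheory GRing.Theory Num.Theory.
Local Open Scope classical_set_scope.
Local Open Scope ring_scope.

(** Why the relaxations are tight.  Write [x] and [y] for the two halves of the
    minimizer [zs].  The diagonal of [Omega] pairs each [x_i] with its own
    [y_i], and the first row of [Omega], together with [x_1 = 1], prescribes
    [y_j] as the matrix entry [A_1j].  A feasible [Z] of either relaxation
    therefore satisfies [Z_11 = 1], [y_j <= Z_(1,N+j)] and
    [x_i * y_i <= Z_(i,N+i)], where the inequalities are equalities when
    [theta] is [false].

    The pairs [(i, N+i)] partition the indices, so it suffices to bound each
    [Z_ii + Z_(N+i,N+i)] from below by [x_i^2 + y_i^2]
    ([psd_pair_diag_ge]).  Positive semidefiniteness on the plane of [1] and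
    [N+i] gives [Z_(N+i,N+i) >= y_i^2]; on the plane of [i] and [N+i] it trades
    a small [Z_ii] for a large [Z_(N+i,N+i)], at a rate which is unfavourable
    precisely because [x_i <= y_i].  Summing over [i] yields
    [\tr Z >= \sum_k zs_k^2] ([psd_trace_ge]).

    The remaining part of the objective of the relaxation is a nonnegative
    multiple of the sum of the [Z_(i,N+j)] over [Omega], each of which is at
    least [A_ij], its value at [zs *m zs^T].  Hence [zs *m zs^T] is optimal.
    Since [z |-> z *m z^T] maps the feasible points of each original problem to
    feasible points of its relaxation with the same objective value
    ([R_feas_outer], [R_obj_outer]), [zs] is optimal for both original
    problems, and the optimal values agree. *)

(** * Optimal values and lifted minimizers *)

Lemma optimal_value_minimizer (R : realType) (T : Type) (F : set T) (f : T -> R)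
    (x : T) :
  is_minimizer F f x -> optimal_value F f = (f x)%:E.
Proof.
move=> [Fx fmin]; apply/eqP; rewrite eq_le; apply/andP; split.
  by apply: ereal_inf_lbound; exists x.
by apply: le_ereal_inf_tmp => _ [y Fy <-]; rewrite lee_fin fmin.
Qed.

(** Optimality descends along an objective-preserving relaxation [h] as soon as
    an optimal point of the relaxed problem is the image of a feasible one. *)
Lemma is_minimizer_lift (R : realType) (T U : Type) (F : set T) (G : set U)
    (f : T -> R) (g : U -> R) (h : T -> U) (x : T) :
  (forall y, F y -> G (h y)) -> (forall y, g (h y) = f y) ->
  F x -> is_minimizer G g (h x) -> is_minimizer F f x.
Proof.
move=> hF gh Fx [_ gmin]; split=> // y Fy.
by rewrite -!gh gmin //; apply: hF.
Qed.

(** * Trace inner products and outer products *)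

Section Trdot.
Variables (R : realType) (s : nat).
Implicit Types (M N Z : 'M[R]_s) (z : 'cV[R]_s).

Lemma trdotDl M N Z : trdot (M + N) Z = trdot M Z + trdot N Z.
Proof. by rewrite /trdot mulmxDl mxtraceD. Qed.

Lemma trdotZl a M Z : trdot (a *: M) Z = a * trdot M Z.
Proof. by rewrite /trdot -scalemxAl mxtraceZ. Qed.

Lemma trdotBl M N Z : trdot (M - N) Z = trdot M Z - trdot N Z.
Proof. by rewrite -scaleN1r trdotDl trdotZl mulN1r. Qed.

Lemma trdot_suml (I : finType) (P : pred I) (F : I -> 'M[R]_s) Z :
  trdot (\sum_(i | P i) F i) Z = \sum_(i | P i) trdot (F i) Z.
Proof. by rewrite /trdot mulmx_suml raddf_sum. Qed.

Lemma trdot1 Z : trdot 1%:M Z = \tr Z.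
Proof. by rewrite /trdot mul1mx. Qed.

Lemma trdot_delta i j Z : trdot (delta_mx i j) Z = Z j i.
Proof.
rewrite /trdot -(mul_delta_mx (0 : 'I_1)) -mulmxA mxtrace_mulC.
by rewrite -mulmxA -colE -rowE trace_mx11 !mxE.
Qed.

Lemma trdot_Emx_diag i Z : trdot (Emx R i i) Z = Z i i.
Proof. by rewrite /Emx eqxx trdot_delta. Qed.

Lemma trdot_Emx_offdiag i j Z :
  Z^T = Z -> i != j -> trdot (Emx R i j) Z = 2 * Z i j.
Proof.
move=> Zsym /negbTE ij; rewrite /Emx ij trdotDl !trdot_delta.
by rewrite -{1}Zsym mxE -mulr2n mulr_natl.
Qed.

Lemma outer_mxE z i j : (z *m z^T) i j = z i 0 * z j 0.
Proof. by rewrite mxE big_ord1 !mxE. Qed.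

Lemma mxtrace_outer z : \tr (z *m z^T) = \sum_k z k 0 ^+ 2.
Proof. by apply: eq_bigr => k _; rewrite outer_mxE expr2. Qed.

Lemma outer_psd z : psd_cone (z *m z^T).
Proof.
split=> [|x]; first by rewrite trmx_mul trmxK.
have -> : x^T *m (z *m z^T) *m x = (x^T *m z) *m (x^T *m z)^T.
  by rewrite trmx_mul trmxK !mulmxA.
by rewrite mxE big_ord1 !mxE -expr2 sqr_ge0.
Qed.

Lemma outer_dnn z : (forall k, 0 <= z k 0) -> dnn_cone (z *m z^T).
Proof.
move=> z_ge0; split; first exact: outer_psd.
by move=> i j; rewrite outer_mxE mulr_ge0.
Qed.

Lemma rank_outer z i : z i 0 != 0 -> \rank (z *m z^T) = 1%N.
Proof.
move=> zi; apply/eqP; rewrite eqn_leq (leq_trans (mxrankM_maxl _ _) (rank_leq_col _)).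
rewrite lt0n mxrank_eq0; apply: contra zi => /eqP/matrixP/(_ i i).
by rewrite outer_mxE mxE -expr2 => /eqP; rewrite sqrf_eq0.
Qed.

(** * Lower bounds on the diagonal of a positive semidefinite matrix *)

Lemma psd_plane M i j (a b : R) : psd_cone M ->
  0 <= a ^+ 2 * M i i + 2 * a * b * M i j + b ^+ 2 * M j j.
Proof.
move=> [Msym /(_ (a *: delta_mx i 0 + b *: delta_mx j 0))].
rewrite [(_ + _)^T]raddfD /= ![(_ *: _)^T]linearZ /= !trmx_delta.
rewrite !mulmxDl !mulmxDr -!scalemxAl -!scalemxAr -!rowE -!colE.
rewrite !mxE; have -> : M j i = M i j by rewrite -{1}Msym mxE.
by congr (_ <= _); ring.
Qed.

(** The index [o] is the homogenizing coordinate.  The bound adds the values of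
    the quadratic form of [Z] at two vectors: [e_j - y e_o], with the weight
    [1 - (x/y)^2], which is nonnegative since [x <= y], and [e_i - (x/y) e_j],
    with the weight [1].  Both vanish at the rank-one matrix to be certified. *)
Lemma psd_pair_diag_ge Z o i j (x y : R) :
  psd_cone Z -> Z o o = 1 -> 0 <= x <= y -> 0 < y ->
  y <= Z o j -> x * y <= Z i j ->
  x ^+ 2 + y ^+ 2 <= Z i i + Z j j.
Proof.
move=> Zpsd Zoo /andP[x0 xy] y0 Zoj Zij.
pose t := x / y.
have t0 : 0 <= t by rewrite divr_ge0 // ltW.
have t1 : t <= 1 by rewrite ler_pdivrMr // mul1r.
have xE : x = t * y by rewrite divfK // gt_eqF.
have v_ge : y ^+ 2 <= Z j j.
  have := psd_plane o j (- y) 1 Zpsd; rewrite Zoo.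
  have : y * y <= y * Z o j by rewrite ler_wpM2l // ltW.
  by lra.
have u_ge : 2 * t * (x * y) <= Z i i + t ^+ 2 * Z j j.
  have := psd_plane i j 1 (- t) Zpsd.
  have : t * (x * y) <= t * Z i j by rewrite ler_wpM2l.
  by lra.
have : (1 - t ^+ 2) * y ^+ 2 <= (1 - t ^+ 2) * Z j j.
  by rewrite ler_wpM2l // subr_ge0 expr_le1.
have -> : x ^+ 2 + y ^+ 2 = 2 * t * (x * y) + (1 - t ^+ 2) * y ^+ 2.
  by rewrite xE; ring.
by lra.
Qed.

End Trdot.

Lemma psd_trace_ge (R : realType) (m : nat) (Z : 'M[R]_(m + m))
    (z : 'cV[R]_(m + m)) (o : 'I_(m + m)) :
  psd_cone Z -> Z o o = 1 ->
  (forall i, [/\ 0 <= z (lshift m i) 0 <= z (rshift m i) 0,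
                 0 < z (rshift m i) 0,
                 z (rshift m i) 0 <= Z o (rshift m i)
               & z (lshift m i) 0 * z (rshift m i) 0
                   <= Z (lshift m i) (rshift m i)]) ->
  \sum_k z k 0 ^+ 2 <= \tr Z.
Proof.
move=> Zpsd Zoo zP; rewrite /mxtrace !big_split_ord /= -!big_split /=.
apply: ler_sum => i _; have [? ? ? ?] := zP i.
exact: (@psd_pair_diag_ge _ _ _ o).
Qed.

(** * The relaxations *)

Section Relaxation.
Variables (R : realType) (n : nat).
Implicit Types (A : 'M[R]_n.+2) (z : 'cV[R]_(n.+2 + n.+2)).
Implicit Types (Z : 'M[R]_(n.+2 + n.+2)) (theta : bool).

Lemma Omega_diag (i : 'I_n.+2) : (i, i) \in Omega n.
Proof. by rewrite !inE /= eqxx. Qed.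

Lemma Omega_row (j : 'I_n.+2) : (ord0, j) \in Omega n.
Proof.
rewrite !inE /= xpair_eqE eqxx /= -!val_eqE /=.
by have := ltn_ord j; lia.
Qed.

Lemma R_constrE A p Z : Z^T = Z -> Z (idx1 n) (idx1 n) = 1 ->
  trdot ((2 * A p.1 p.2) *: Emx R (idx1 n) (idx1 n)
         - Emx R (lshift n.+2 p.1) (rshift n.+2 p.2)) Z
  = 2 * (A p.1 p.2 - Z (lshift n.+2 p.1) (rshift n.+2 p.2)).
Proof.
move=> Zsym Z11; rewrite trdotBl trdotZl trdot_Emx_diag Z11.
by rewrite trdot_Emx_offdiag ?eq_lrshift // mulr1 mulrBr.
Qed.

Lemma R_objE (rho : R) theta Z : Z^T = Z ->
  R_obj rho theta Z
  = \tr Z + theta%:R * (2 * rho * \sum_(p in Omega n)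
                          Z (lshift n.+2 p.1) (rshift n.+2 p.2)).
Proof.
move=> Zsym; rewrite /R_obj trdotDl trdot1 trdotZl trdot_suml.
rewrite (eq_bigr (fun p => 2 * Z (lshift n.+2 p.1) (rshift n.+2 p.2))).
  by rewrite -mulr_sumr; congr (_ + _); ring.
by move=> p _; rewrite trdot_Emx_offdiag ?eq_lrshift.
Qed.

Lemma R_feas_ge A (r : R) (K : set 'M[R]_(n.+2 + n.+2)) theta Z :
  K `<=` @psd_cone R (n.+2 + n.+2) -> R_feas A r K theta Z ->
  [/\ psd_cone Z, Z (idx1 n) (idx1 n) = 1
    & forall p, p \in Omega n ->
        A p.1 p.2 <= Z (lshift n.+2 p.1) (rshift n.+2 p.2)].
Proof.
move=> Kpsd [/Kpsd Zpsd [Zcst _ Z11 _]]; split=> // p pO; have {Zcst} := Zcst p pO.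
rewrite /= R_constrE //; last by case: Zpsd.
by case: theta; lra.
Qed.

Lemma R_feas_outer A (r : R) (K : set 'M[R]_(n.+2 + n.+2)) theta z :
  @dnn_cone R (n.+2 + n.+2) `<=` K ->
  (if theta then P'_feas A r else P_feas A r) z ->
  R_feas A r K theta (z *m z^T).
Proof.
move=> dnnK zfeas.
have [zr z1 z_ge0] : [/\ \sum_k z k 0 ^+ 2 <= r, z (idx1 n) 0 = 1
    & forall k, 0 <= z k 0] by case: theta zfeas => -[].
have [zsym _] := outer_psd z.
have Z11 : (z *m z^T) (idx1 n) (idx1 n) = 1 by rewrite outer_mxE z1 mulr1.
split; first exact/dnnK/outer_dnn.
split=> [p pO /=|||j j1].
- rewrite R_constrE // outer_mxE.
  by case: theta zfeas => -[/(_ p pO)]; lra.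
- by rewrite trdotBl trdot1 trdotZl trdot_Emx_diag Z11 mxtrace_outer mulr1 subr_le0.
- by [].
- by rewrite trdot_Emx_offdiag 1?eq_sym // outer_mxE !mulr_ge0.
Qed.

Lemma R_obj_outer (rho : R) theta z :
  R_obj rho theta (z *m z^T)
  = (if theta then P'_obj rho else @P_obj R n) z.
Proof.
have [zsym _] := outer_psd z.
rewrite R_objE // mxtrace_outer; case: theta; last by rewrite mul0r addr0.
rewrite mul1r; congr (_ + _ * _).
by apply: eq_bigr => p _; rewrite outer_mxE.
Qed.

Lemma P_feas_P'_feas A (r : R) : P_feas A r `<=` P'_feas A r.
Proof. by move=> z [zA zr z1 z0]; split=> // p /zA ->. Qed.

(** The lifted point minimizes the trace and the penalty term separately: the
    trace by [psd_trace_ge], the penalty because its entries meet their lower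
    bounds [A_ij] with equality. *)
Lemma outer_minimizer A (r rho : R) (K : set 'M[R]_(n.+2 + n.+2)) theta z :
  (forall p, p \in Omega n -> 0 < A p.1 p.2) -> 0 <= rho ->
  @dnn_cone R (n.+2 + n.+2) `<=` K -> K `<=` @psd_cone R (n.+2 + n.+2) ->
  P_feas A r z ->
  (forall i : 'I_n.+2, z (lshift n.+2 i) 0 <= z (rshift n.+2 i) 0) ->
  is_minimizer (R_feas A r K theta) (R_obj rho theta) (z *m z^T).
Proof.
move=> A0 rho0 dnnK Kpsd zfeas zxy; split.
  by apply: R_feas_outer => //; case: theta => //; apply: P_feas_P'_feas.
have [zA _ z1 z0] := zfeas.
have zE p : p \in Omega n ->
    z (lshift n.+2 p.1) 0 * z (rshift n.+2 p.2) 0 = A p.1 p.2.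
  by move=> /zA; lra.
have zy j : z (rshift n.+2 j) 0 = A ord0 j.
  by have := zE _ (Omega_row j); rewrite /= -/(idx1 n) z1 mul1r.
move=> Z /(R_feas_ge Kpsd)[Zpsd Z11 ZA].
rewrite !R_objE ?mxtrace_outer; [|by case: Zpsd|by case: (outer_psd z)].
apply: lerD; last first.
  rewrite !ler_wpM2l ?mulr_ge0 ?ler0n //.
  by apply: ler_sum => p pO; rewrite outer_mxE zE // ZA.
apply: (@psd_trace_ge _ _ _ _ (idx1 n)) => // i; split.
- by rewrite z0 zxy.
- by rewrite zy; exact: A0 (Omega_row i).
- by rewrite zy; exact: ZA (Omega_row i).
- by rewrite (zE (i, i)) ?Omega_diag //; exact: ZA (Omega_diag i).
Qed.

End Relaxation.

Theorem theorem4p8 (R : realType) (n : nat) (A : 'M[R]_n.+2)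
    (A_gt0 : forall p, p \in Omega n -> 0 < A p.1 p.2) :
  exists r0 rho0 : R, 0 < r0 /\ 0 < rho0 /\
  forall r rho : R, r0 <= r -> rho0 <= rho ->
  forall (zs : 'cV[R]_(n.+2 + n.+2)) (K : set 'M[R]_(n.+2 + n.+2)),
    is_minimizer (P_feas A r) (@P_obj R n) zs ->
    (K = @psd_cone R (n.+2 + n.+2) \/ K = @dnn_cone R (n.+2 + n.+2)) ->
    (forall p, p \in Omega n ->
       1 <= zs (rshift n.+2 p.2) 0 / zs (lshift n.+2 p.1) 0) ->
    (forall theta : bool,
       \rank (zs *m zs^T) = 1%N /\
       is_minimizer (R_feas A r K theta) (@R_obj R n rho theta) (zs *m zs^T)) /\
    optimal_value (R_feas A r K false) (@R_obj R n rho false)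
      = optimal_value (P_feas A r) (@P_obj R n) /\
    optimal_value (R_feas A r K true) (@R_obj R n rho true)
      = optimal_value (P'_feas A r) (@P'_obj R n rho).
Proof.
(* The threshold for rho makes the penalty term nondecreasing in Z. *)
exists 1, 1; split=> //; split=> // r rho _ rho1 zs K zsmin KE zs_ratio.
have [dnnK Kpsd] : @dnn_cone R (n.+2 + n.+2) `<=` K /\
    K `<=` @psd_cone R (n.+2 + n.+2).
  by case: KE => ->; split=> // M [].
have [zs_feas _] := zsmin; have [zsA _ zs1 zs0] := zs_feas.
have zs_le i : zs (lshift n.+2 i) 0 <= zs (rshift n.+2 i) 0.
  have := zs_ratio _ (Omega_diag i); rewrite /= ler_pdivlMr ?mul1r //.
  rewrite lt_def zs0 andbT; apply/eqP => x0.
  have := A_gt0 _ (Omega_diag i); have := zsA _ (Omega_diag i).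
  by rewrite /= x0; lra.
have Rmin theta : is_minimizer (R_feas A r K theta) (@R_obj R n rho theta)
    (zs *m zs^T).
  by apply: outer_minimizer => //; apply: le_trans rho1.
have P'min : is_minimizer (P'_feas A r) (@P'_obj R n rho) zs.
  apply: (is_minimizer_lift (h := fun z => z *m z^T)) (Rmin true).
  - by move=> z zfeas; apply: R_feas_outer.
  - by move=> z; rewrite R_obj_outer.
  - exact: P_feas_P'_feas.
split=> [theta|]; last split.
- by split=> //; apply: (rank_outer (i := idx1 n)); rewrite zs1 oner_neq0.
- by rewrite (optimal_value_minimizer (Rmin false))
             (optimal_value_minimizer zsmin) R_obj_outer.
- by rewrite (optimal_value_minimizer (Rmin true))
             (optimal_value_minimizer P'min) R_obj_outer.
Qed.
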